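(* Let $(\Omega,\Sigma,\mu)$ be a non-atomic finite measure space and let $Y$ be a (real) Banach space. Then the Lebesgue-Bochner space $L_1(\mu,Y)$ is weakly almost square (WASQ).
   Context: All Banach spaces are real. For a Banach space $X$, $B_X$ and $S_X$ denote its closed unit ball and unit sphere. A Banach space $X$ is weakly almost square (WASQ) if for every $x\in S_X$ there is a weakly null sequence $(y_n)_{n\in\mathbb{N}}$ in $B_X$ such that $\|x+y_n\|\to 1$, $\|x-y_n\|\to 1$ and $\|y_n\|\to 1$. $L_1(\mu,Y)$ is the space of (equivalence classes of) Bochner $\mu$-integrable functions $f:\Omega\to Y$ with norm $\int_\Omega\|f(\cdot)\|\,d\mu$. *)

(* Defs.v *)
From HB Require Import structures.
From mathcomp Require Import all_boot all_order all_algebra generic_quotient.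
From mathcomp Require Import all_classical all_reals all_analysis.
From mathcomp Require Import measurable_realfun lra.

Set Implicit Arguments.
Unset Strict Implicit.
Unset Printing Implicit Defensive.

Import Order.TTheory GRing.Theory Num.Theory.
Import numFieldNormedType.Exports.

Local Open Scope classical_set_scope.
Local Open Scope ring_scope.

Section weakly_almost_square.
Context {R : realType}.

Definition weakly_null (X : normedModType R) (y : nat -> X) : Prop :=
  forall phi : {linear X -> R^o}, continuous phi ->
    phi (y n) @[n --> \oo] --> (0 : R^o).

Definition weakly_almost_square (X : completeNormedModType R) : Prop :=
  forall x : X, `|x| = 1 ->
    exists y : nat -> X,
      [/\ weakly_null y,
          forall n, `|y n| <= 1,
          `|x + y n| @[n --> \oo] --> (1 : R),
          `|x - y n| @[n --> \oo] --> (1 : R) &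
          `|y n| @[n --> \oo] --> (1 : R)].

End weakly_almost_square.

Section nonatomic.
Context d (T : measurableType d) (R : realType).
Implicit Type mu : {measure set T -> \bar R}.

Definition atom mu (A : set T) : Prop :=
  [/\ measurable A, (0 < mu A)%E &
      forall B, measurable B -> B `<=` A -> mu B = 0%E \/ mu (A `\` B) = 0%E].

Definition nonatomic mu : Prop := forall A, ~ atom mu A.

End nonatomic.

Section ae_le_integral.
Context d (T : measurableType d) (R : realType).
Variable mu : {measure set T -> \bar R}.
Local Open Scope ereal_scope.
Import HBNNSimple.

(* No measurability is required here: the integral of a nonnegative function
   is the supremum of the integrals of the simple functions below it. *)
Lemma ae_le_integralT (F G : T -> \bar R) :
  (forall w, 0 <= F w) -> (forall w, 0 <= G w) ->
  {ae mu, forall w, F w <= G w} -> \int[mu]_w F w <= \int[mu]_w G w.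
Proof.
move=> F0 G0 [N [mN N0 FGN]].
rewrite !ge0_integralTE//; apply: ge_ereal_sup => _ [h hF <-].
have mNC : measurable (~` N) by exact: measurableC.
pose h' := proj_nnsfun h mNC.
have -> : sintegral mu h = sintegral mu h'.
  rewrite -!integralT_nnsfun; apply: ae_eq_integral => //.
  - exact/measurable_EFinP.
  - exact/measurable_EFinP.
  - exists N; split => // w /= hw; apply: contrapT => Nw; apply: hw => _.
    by rewrite /= mindicE mem_set ?mulr1.
apply: ereal_sup_ubound; exists h' => //= w.
rewrite mindicE; have [|_] := boolP (w \in ~` N); last by rewrite mulr0.
rewrite inE mulr1 => Nw; apply: (le_trans (hF w)).
by apply: contrapT => /FGN.
Qed.

Lemma ae_eq_integralT (F G : T -> \bar R) :
  (forall w, 0 <= F w) -> (forall w, 0 <= G w) ->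
  F = G %[ae mu] -> \int[mu]_w F w = \int[mu]_w G w.
Proof.
move=> F0 G0 FG; apply/eqP; rewrite eq_le; apply/andP; split;
  apply: ae_le_integralT => //; apply: filterS FG => w /(_ I) /= ->//.
Qed.

End ae_le_integral.

Section simple_functions.
Context d (T : measurableType d).

Definition simple_function (Y : Type) (s : T -> Y) : Prop :=
  finite_set (range s) /\ forall y, measurable (s @^-1` [set y]).

Lemma simple_function_cst (Y : Type) (y : Y) :
  simple_function (fun=> y).
Proof.
split; first by apply: (sub_finite_set _ (finite_set1 y)) => _ [w _ <-].
by move=> z; rewrite preimage_cst; case: ifP.
Qed.

Lemma simple_function_mem (N : set T) :
  measurable N -> simple_function (fun w => w \in N).
Proof.
move=> mN; split; first exact: finite_finset.
move=> b; have [->|->] : b = true \/ b = false by case: b; [left|right].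
- rewrite [X in measurable X](_ : _ = N)//.
  by apply/seteqP; split => w /=; [exact: set_mem|exact: mem_set].
- rewrite [X in measurable X](_ : _ = ~` N); first exact: measurableC.
  apply/seteqP; split => w /=; first by move=> wN /mem_set; rewrite wN.
  by move=> Nw; apply/negP => /set_mem.
Qed.

Lemma simple_function_op (Y Z U : Type) (op : Y -> Z -> U) s t :
  simple_function s -> simple_function t ->
  simple_function (fun w => op (s w) (t w)).
Proof.
move=> [fs ms] [ft mt].
have fst : finite_set (range s `*` range t) by exact: finite_setX.
split.
  apply: (sub_finite_set _ (finite_image (fun p => op p.1 p.2) fst)).
  by move=> _ [w _ <-]; exists (s w, t w).
move=> y.
rewrite [X in measurable X](_ : _ =
    \bigcup_(p in (range s `*` range t) `&` [set p | op p.1 p.2 = y])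
      (s @^-1` [set p.1] `&` t @^-1` [set p.2])).
  apply: fin_bigcup_measurable; first exact: finite_setIl.
  by move=> p _; exact: measurableI.
apply/seteqP; split => [w /= sty|w [p [_ /= <-] [/= -> ->]]//].
by exists (s w, t w).
Qed.

Lemma simple_function_measurable (R : realType) (s : T -> R) :
  simple_function s -> measurable_fun setT s.
Proof.
move=> [fs ms] _ B mB; rewrite setTI.
rewrite [X in measurable X](_ : _ =
    \bigcup_(y in range s `&` B) (s @^-1` [set y])).
  by apply: fin_bigcup_measurable => //; exact: finite_setIl.
apply/seteqP; split => [w /= Bsw|w [y [_ By] /= ->]//].
by exists (s w).
Qed.

End simple_functions.

Section bochner.
Context d (T : measurableType d) (R : realType).
Variable mu : {finite_measure set T -> \bar R}.

(* Measurability in the sense of Bochner, i.e. up to a null set: f need not be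
   Borel measurable when mu is not complete. *)
Definition strongly_measurable (Y : normedModType R) (f : T -> Y) : Prop :=
  exists2 s : nat -> T -> Y, (forall n, simple_function (s n)) &
    {ae mu, forall w, s n w @[n --> \oo] --> f w}.

(* As mu is finite, the simple functions s n are automatically integrable.
   The norm of [f - s n] is measurable only up to a null set; this does not
   affect the value of its integral (see ae_eq_integralT). *)
Definition bochner_integrable (Y : normedModType R) (f : T -> Y) : Prop :=
  strongly_measurable f /\
  exists2 s : nat -> T -> Y, (forall n, simple_function (s n)) &
    (\int[mu]_w (`|f w - s n w|%:E) @[n --> \oo] --> 0)%E.

Section theory.
Context {Y : normedModType R}.
Implicit Types (f g s : T -> Y).

Lemma simple_strongly_measurable s :
  simple_function s -> strongly_measurable s.
Proof. by move=> ss; exists (fun=> s) => //; apply/aeW => w; exact: cvg_cst. Qed.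

Lemma strongly_measurable_lin (a : R) f g : strongly_measurable f ->
  strongly_measurable g -> strongly_measurable (a *: f + g).
Proof.
move=> [s ss sf] [t st tg]; exists (fun n => a *: s n + t n).
  by move=> n; apply: (simple_function_op (fun y z => a *: y + z)).
apply: filterS2 sf tg => w sfw tgw.
by apply: cvgD => //; apply: cvgZl_tmp.
Qed.

Lemma strongly_measurableZ (a : R) f :
  strongly_measurable f -> strongly_measurable (a *: f).
Proof.
move=> fm; rewrite -[_ *: _]addr0; apply: strongly_measurable_lin => //.
exact/simple_strongly_measurable/simple_function_cst.
Qed.

Lemma strongly_measurableB f g : strongly_measurable f ->
  strongly_measurable g -> strongly_measurable (f - g).
Proof.
move=> fm gm; rewrite addrC -scaleN1r.
exact: strongly_measurable_lin.
Qed.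

Lemma strongly_measurableD f g : strongly_measurable f ->
  strongly_measurable g -> strongly_measurable (f + g).
Proof. by move=> fm gm; rewrite -[f]scale1r; exact: strongly_measurable_lin. Qed.

Lemma lim_simple_measurable_norm (s : nat -> T -> Y) g :
  (forall n, simple_function (s n)) ->
  (forall w, s n w @[n --> \oo] --> g w) ->
  measurable_fun setT (fun w => `|g w|).
Proof.
move=> ss sg.
have ms n : measurable_fun setT (fun w => `|s n w|).
  apply: simple_function_measurable.
  exact: (simple_function_op (fun y _ : Y => `|y|) (ss n) (ss n)).
have sgn w : [set: T] w -> `|s n w| @[n --> \oo] --> (`|g w| : R).
  by move=> _; apply: cvg_norm; exact: sg.
exact: (measurable_fun_cvg ms sgn).
Qed.

Lemma strongly_measurable_lim f : strongly_measurable f ->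
  exists g (s : nat -> T -> Y), [/\ forall n, simple_function (s n),
    forall w, s n w @[n --> \oo] --> g w & f = g %[ae mu]].
Proof.
move=> [s ss [N [mN N0 sN]]].
pose cut h w : Y := if w \in N then 0 else h w.
exists (cut f), (fun n => cut (s n)); split.
- move=> n; have := simple_function_op (fun (b : bool) y => if b then 0 else y).
  by apply => //; exact: simple_function_mem.
- move=> w; rewrite /cut; case: ifPn => [_|wN]; first exact: cvg_cst.
  by apply: contrapT => /sN/mem_set; apply/negP.
- exists N; split=> // w /= /not_implyP[_]; apply: contra_notP => wN.
  by rewrite /cut ifN// notin_setE.
Qed.

Local Open Scope ereal_scope.

Lemma ae_eq_integral_norm f g : f = g %[ae mu] ->
  \int[mu]_w `|f w|%:E = \int[mu]_w `|g w|%:E.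
Proof.
move=> fg; apply: ae_eq_integralT => [w|w|]; rewrite ?lee_fin//.
by apply: filterS fg => w /(_ I) ->.
Qed.

Lemma integral_normD f g : strongly_measurable f -> strongly_measurable g ->
  \int[mu]_w `|(f + g)%R w|%:E <=
  \int[mu]_w `|f w|%:E + \int[mu]_w `|g w|%:E.
Proof.
move=> /strongly_measurable_lim[f' [s [ss sf ff']]].
move=> /strongly_measurable_lim[g' [t [st tg gg']]].
have mf := lim_simple_measurable_norm ss sf.
have mg := lim_simple_measurable_norm st tg.
rewrite (ae_eq_integral_norm ff') (ae_eq_integral_norm gg').
rewrite -ge0_integralD//; last 2 first.
- exact/measurable_EFinP.
- exact/measurable_EFinP.
apply: ae_le_integralT => [w|w|]; first by rewrite lee_fin.
  by rewrite adde_ge0// lee_fin.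
apply: filterS2 ff' gg' => w /(_ I) fw /(_ I) gw.
by rewrite -EFinD lee_fin -fw -gw ler_normD.
Qed.

Lemma integral_normZ (a : R) f : strongly_measurable f ->
  \int[mu]_w `|(a *: f)%R w|%:E = `|a|%:E * \int[mu]_w `|f w|%:E.
Proof.
move=> /strongly_measurable_lim[f' [s [ss sf ff']]].
have mf := lim_simple_measurable_norm ss sf.
rewrite (ae_eq_integral_norm ff') -ge0_integralZl//; last first.
  exact/measurable_EFinP.
apply: ae_eq_integralT => [w|w|]; rewrite ?mule_ge0 ?lee_fin//.
apply: filterS ff' => w /(_ I) fw _.
by rewrite -EFinM -normrZ -fw.
Qed.

Lemma integral_norm_eq0 f : strongly_measurable f ->
  \int[mu]_w `|f w|%:E = 0 -> f = 0%R %[ae mu].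
Proof.
move=> /strongly_measurable_lim[f' [s [ss sf ff']]].
have mf := lim_simple_measurable_norm ss sf.
have mEf : measurable_fun setT (fun w => `|f' w|%:E) by exact/measurable_EFinP.
rewrite (ae_eq_integral_norm ff') => f'0.
have /(ae_eq_integral_abs mu measurableT mEf) : \int[mu]_w `| `|f' w|%:E | = 0.
  by rewrite -f'0; apply: eq_integral => w _; rewrite gee0_abs// lee_fin.
apply: filterS2 ff' => w /(_ I) -> /(_ I) [] /eqP.
by rewrite normr_eq0 => /eqP.
Qed.

Lemma simple_integral_norm_fin s : simple_function s ->
  \int[mu]_w `|s w|%:E < +oo.
Proof.
move=> ss.
have [M sM] : exists M : R, forall w, (`|s w| <= M)%R.
  have [fs _] := simple_function_op (fun y _ : Y => `|y|%R) ss ss.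
  have [M [_ sM]] := @compact_bounded _ R^o _ (finite_compact fs).
  exists (M + 1)%R => w.
  have := sM (M + 1)%R; rewrite ltrDl ltr01 => /(_ isT) /(_ `|s w|)%R.
  by rewrite /= normr_id; apply; exists w.
apply: (@le_lt_trans _ _ (\int[mu]_w (cst M%:E w))).
  apply: ae_le_integralT => [w|w|]; rewrite ?lee_fin//.
    exact: le_trans (sM w).
  by apply/aeW => w; rewrite lee_fin.
rewrite integral_cst// ltey_eq fin_numM//.
exact: fin_num_measure.
Qed.

Lemma bochner_integrable_fin f : bochner_integrable f ->
  \int[mu]_w `|f w|%:E \is a fin_num.
Proof.
move=> [fm [s ss sf]].
rewrite ge0_fin_numE; last by apply: integral_ge0 => w _; rewrite lee_fin.
have /fine_cvgP[[n _ nfin] _] := sf.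
have {}nfin := nfin n (leqnn n).
rewrite -[f](subrK (s n)); apply: le_lt_trans (integral_normD _ _) _.
- exact/strongly_measurableB/simple_strongly_measurable.
- exact: simple_strongly_measurable.
rewrite lte_add_pinfty//; last exact: simple_integral_norm_fin.
by rewrite ltey_eq nfin.
Qed.

Lemma bochner_integrable0 : bochner_integrable (0%R : T -> Y).
Proof.
have s0 := @simple_function_cst _ T _ (0%R : Y).
split; first exact: simple_strongly_measurable.
exists (fun=> cst 0%R) => //; under eq_fun.
  move=> n; under eq_integral do rewrite subrr normr0.
  rewrite integral0; over.
exact: cvg_cst.
Qed.

Lemma bochner_integrable_lin (a : R) f g : bochner_integrable f ->
  bochner_integrable g -> bochner_integrable (a *: f + g : T -> Y)%R.
Proof.
move=> [fm [s ss sf]] [gm [t st tg]].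
split; first exact: strongly_measurable_lin.
exists (fun n => a *: s n + t n)%R.
  by move=> n; apply: (simple_function_op (fun y z => a *: y + z)%R).
apply: (@squeeze_cvge _ _ _ _ (cst 0) _
  (fun n => `|a|%:E * \int[mu]_w `|f w - s n w|%:E +
            \int[mu]_w `|g w - t n w|%:E)).
- apply: nearW => n; apply/andP; split.
    by apply: integral_ge0 => w _; rewrite lee_fin.
  have fs : strongly_measurable (f - s n)%R.
    exact/strongly_measurableB/simple_strongly_measurable.
  have gt : strongly_measurable (g - t n)%R.
    exact/strongly_measurableB/simple_strongly_measurable.
  have := integral_normZ a fs => /= <-.
  apply: le_trans (integral_normD (strongly_measurableZ a fs) gt).
  apply: ae_le_integralT => [w|w|]; rewrite ?lee_fin//.
  apply/aeW => w; rewrite lee_fin.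
  rewrite -[(_ + _ : T -> Y)%R w]/(a *: (f w - s n w) + (g w - t n w))%R.
  rewrite -[(a *: f + g)%R w]/(a *: f w + g w)%R.
  rewrite -[(a *: s n + t n)%R w]/(a *: s n w + t n w)%R.
  by rewrite scalerBr addrACA -opprD.
- exact: cvg_cst.
- rewrite -[X in _ --> X](adde0 0) -[X in _ --> X + _](mule0 `|a|%:E).
  by apply: cvgeD => //; exact: cvgeZl.
Qed.

End theory.
End bochner.

Section bochner_type.
Context d (T : measurableType d) (R : realType).
Variables (mu : {finite_measure set T -> \bar R}) (Y : normedModType R).

Definition bochner_pred : {pred T -> Y} := mem [set f | bochner_integrable mu f].

Lemma bochner_predP (f : T -> Y) :
  reflect (bochner_integrable mu f) (f \in bochner_pred).
Proof. by apply: (iffP idP) => [/set_mem|/mem_set]. Qed.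

Record bochner := Bochner {
  bochner_fun :> T -> Y;
  bochner_funP : bochner_fun \in bochner_pred }.

HB.instance Definition _ := [isSub for bochner_fun].
HB.instance Definition _ := [Choice of bochner by <:].

Lemma bochner_submod_closed : submod_closed bochner_pred.
Proof.
split; first exact/bochner_predP/bochner_integrable0.
move=> a f g /bochner_predP fb /bochner_predP gb.
exact/bochner_predP/bochner_integrable_lin.
Qed.

HB.instance Definition _ := GRing.isSubmodClosed.Build _ _ bochner_pred
  bochner_submod_closed.
HB.instance Definition _ := [SubChoice_isSubLmodule of bochner by <:].

Lemma bochnerP (f : bochner) : bochner_integrable mu f.
Proof. exact/bochner_predP/bochner_funP. Qed.

Lemma bochner_measurable (f : bochner) : strongly_measurable mu f.
Proof. by have [] := bochnerP f. Qed.

Definition bochner_ae_eq (f g : bochner) : bool := `[< f = g %[ae mu] >].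

Let bochner_ae_eq_refl : reflexive bochner_ae_eq.
Proof. by move=> f; exact/asboolP/aeW. Qed.

Let bochner_ae_eq_sym : symmetric bochner_ae_eq.
Proof. by move=> f g; apply/asboolP/asboolP; exact: ae_eq_sym. Qed.

Let bochner_ae_eq_trans : transitive bochner_ae_eq.
Proof.
by move=> g f h /asboolP fg /asboolP gh; apply/asboolP; exact: ae_eq_trans fg gh.
Qed.

Canonical bochner_ae_equiv := EquivRel bochner_ae_eq
  bochner_ae_eq_refl bochner_ae_eq_sym bochner_ae_eq_trans.

Local Open Scope quotient_scope.

Definition L1 : Type := {eq_quot bochner_ae_eq}.
HB.instance Definition _ := Choice.on L1.
HB.instance Definition _ := EqQuotient.on L1.

Implicit Types (f g : bochner) (x y z : L1).

Lemma L1_eqP f g : \pi_L1 f = \pi_L1 g <-> (f : T -> Y) = g %[ae mu].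
Proof.
split=> [/eqP|fg]; first by rewrite eqmodE => /asboolP.
by apply/eqP; rewrite eqmodE; exact/asboolP.
Qed.

Lemma L1_repr f : (repr (\pi_L1 f) : T -> Y) = f %[ae mu].
Proof. by apply/L1_eqP; rewrite reprK. Qed.

Lemma L1_pi x : exists f, x = \pi_L1 f.
Proof. by exists (repr x); rewrite reprK. Qed.

Definition L1_zero : L1 := \pi_L1 0.
Definition L1_opp x : L1 := \pi_L1 (- repr x).
Definition L1_add x y : L1 := \pi_L1 (repr x + repr y).
Definition L1_scale (a : R) x : L1 := \pi_L1 (a *: repr x).
Definition L1_norm x : R := \int[mu]_w `|repr x w|.

Lemma L1_oppE f : L1_opp (\pi_L1 f) = \pi_L1 (- f).
Proof.
apply/L1_eqP; apply: filterS (L1_repr f) => w /(_ I) fw _.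
by rewrite -[LHS]/(- (repr (\pi_L1 f) w)) fw.
Qed.

Lemma L1_addE f g : L1_add (\pi_L1 f) (\pi_L1 g) = \pi_L1 (f + g).
Proof.
apply/L1_eqP; apply: filterS2 (L1_repr f) (L1_repr g) => w /(_ I) fw /(_ I) gw _.
by rewrite -[LHS]/(repr (\pi_L1 f) w + repr (\pi_L1 g) w) fw gw.
Qed.

Lemma L1_scaleE a f : L1_scale a (\pi_L1 f) = \pi_L1 (a *: f).
Proof.
apply/L1_eqP; apply: filterS (L1_repr f) => w /(_ I) fw _.
by rewrite -[LHS]/(a *: repr (\pi_L1 f) w) fw.
Qed.

Lemma L1_normE f : L1_norm (\pi_L1 f) = \int[mu]_w `|f w|.
Proof. by congr fine; apply: ae_eq_integral_norm; exact: L1_repr. Qed.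

Let L1_addA : associative L1_add.
Proof.
move=> xf xg xh.
have [f ->] := L1_pi xf; have [g ->] := L1_pi xg; have [h ->] := L1_pi xh.
by rewrite !L1_addE addrA.
Qed.

Let L1_addC : commutative L1_add.
Proof.
move=> xf xg.
have [f ->] := L1_pi xf; have [g ->] := L1_pi xg.
by rewrite !L1_addE addrC.
Qed.

Let L1_add0 : left_id L1_zero L1_add.
Proof.
move=> xf.
have [f ->] := L1_pi xf.
by rewrite L1_addE add0r.
Qed.

Let L1_addN : left_inverse L1_zero L1_opp L1_add.
Proof.
move=> xf.
have [f ->] := L1_pi xf.
by rewrite L1_oppE L1_addE addNr.
Qed.

HB.instance Definition _ :=
  GRing.isZmodule.Build L1 L1_addA L1_addC L1_add0 L1_addN.

Let L1_scaleA a b x : L1_scale a (L1_scale b x) = L1_scale (a * b) x.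
Proof. by have [f ->] := L1_pi x; rewrite !L1_scaleE scalerA. Qed.

Let L1_scale1 : left_id 1 L1_scale.
Proof.
move=> xf.
have [f ->] := L1_pi xf.
by rewrite L1_scaleE scale1r.
Qed.

Let L1_scaleDr : right_distributive L1_scale +%R.
Proof.
move=> a xf xg.
have [f ->] := L1_pi xf; have [g ->] := L1_pi xg.
by rewrite /GRing.add/= !(L1_scaleE, L1_addE) scalerDr.
Qed.

Let L1_scaleDl x : {morph L1_scale^~ x : a b / a + b}.
Proof.
move=> a b; have [f ->] := L1_pi x.
by rewrite [RHS]/GRing.add/= !(L1_scaleE, L1_addE) scalerDl.
Qed.

HB.instance Definition _ := GRing.Zmodule_isLmodule.Build R L1
  L1_scaleA L1_scale1 L1_scaleDr L1_scaleDl.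

Lemma L1_piD f g : \pi_L1 (f + g) = \pi_L1 f + \pi_L1 g.
Proof. by rewrite -L1_addE. Qed.

Lemma L1_piN f : \pi_L1 (- f) = - \pi_L1 f.
Proof. by rewrite -L1_oppE. Qed.

Lemma L1_piB f g : \pi_L1 (f - g) = \pi_L1 f - \pi_L1 g.
Proof. by rewrite L1_piD L1_piN. Qed.

Lemma L1_piZ a f : \pi_L1 (a *: f) = a *: \pi_L1 f.
Proof. by rewrite -L1_scaleE. Qed.

Lemma bochner_normK f :
  ((\int[mu]_w `|f w|)%:E = \int[mu]_w (`|f w|%:E))%E.
Proof. by rewrite fineK//; exact/bochner_integrable_fin/bochnerP. Qed.

Let L1_ler_normD x y : L1_norm (x + y) <= L1_norm x + L1_norm y.
Proof.
have [f ->] := L1_pi x; have [g ->] := L1_pi y; rewrite -L1_piD !L1_normE -lee_fin.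
rewrite EFinD !bochner_normK.
exact: integral_normD (bochner_measurable f) (bochner_measurable g).
Qed.

Let L1_normrZ a x : L1_norm (a *: x) = `|a| * L1_norm x.
Proof.
have [f ->] := L1_pi x; rewrite -L1_piZ !L1_normE; apply: EFin_inj.
rewrite EFinM !bochner_normK.
exact: (integral_normZ a (bochner_measurable f)).
Qed.

Let L1_norm0_eq0 x : L1_norm x = 0 -> x = 0.
Proof.
have [f ->] := L1_pi x; rewrite L1_normE => f0.
apply/L1_eqP; apply: integral_norm_eq0; first exact: bochner_measurable.
by rewrite -bochner_normK f0.
Qed.

HB.instance Definition _ := Lmodule_isNormed.Build R L1
  L1_ler_normD L1_normrZ L1_norm0_eq0.

Lemma norm_L1_pi f : `|\pi_L1 f| = \int[mu]_w `|f w|.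
Proof. exact: L1_normE. Qed.

End bochner_type.

Section bochner_complete.
Context d (T : measurableType d) (R : realType).
Variables (mu : {finite_measure set T -> \bar R}) (Y : completeNormedModType R).

Lemma bochner_simple_limit (s : nat -> T -> Y) (c : R) : 0 <= c ->
  (forall n, simple_function (s n)) ->
  (forall n, \int[mu]_w (`|s n.+1 w - s n w|%:E) <= (c / (2 ^ n.+1)%:R)%:E)%E ->
  exists2 f : T -> Y, bochner_integrable mu f &
    forall n, (\int[mu]_w (`|f w - s n w|%:E) <= (c / (2 ^ n)%:R)%:E)%E.
Proof.
move=> c0 ss sc.
pose D k w := `|s k.+1 w - s k w|.
have mD k : measurable_fun setT (fun w => (D k w)%:E).
  apply/measurable_EFinP; apply: simple_function_measurable.
  exact: (simple_function_op (fun y z : Y => `|y - z|) (ss k.+1) (ss k)).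
have D0 k w : (0 <= (D k w)%:E)%E by rewrite lee_fin /D.
pose G n w := (\sum_(0 <= k <oo) (D (n + k)%N w)%:E)%E.
have G0 n w : (0 <= G n w)%E by exact: nneseries_ge0.
have intG n : (\int[mu]_w G n w <= (c / (2 ^ n)%:R)%:E)%E.
  rewrite integral_nneseries//.
  apply: le_trans (epsilon_trick0 xpredT _); last first.
    by rewrite divr_ge0.
  apply: lee_nneseries => [k _ _|k _].
    by apply: integral_ge0.
  apply: le_trans (sc (n + k)%N) _.
  by rewrite -addnS expnD natrM invfM mulrA.
have mG n : measurable_fun setT (G n).
  exact: (@ge0_emeasurable_sum _ _ _ setT (fun k w => (D (n + k)%N w)%:E) xpredT).
have Gfin : {ae mu, forall w, G 0%N w \is a fin_num}.
  have iG : mu.-integrable setT (G 0%N).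
    apply/integrableP; split => //.
    under eq_integral do rewrite gee0_abs//.
    by apply: le_lt_trans (intG 0%N) _; rewrite ltry.
  by apply: filterS (integrable_ae measurableT iG) => w /(_ I).
pose f w := limn (s ^~ w).
have sf : {ae mu, forall w, s n w @[n --> \oo] --> f w}.
  apply: filterS Gfin => w Gw.
  suff : cvgn (series (telescope (s ^~ w))).
    rewrite telescopeK => cvs.
    apply/cvg_ex; exists (limn [sequence s n w - s 0%N w]_n + s 0%N w).
    rewrite (_ : s ^~ w = fun n => s n w - s 0%N w + s 0%N w).
      by apply: cvgD; [exact: cvs|exact: cvg_cst].
    by apply/funext => n; rewrite subrK.
  apply: normed_cvg; rewrite /=.
  apply: nondecreasing_is_cvgn.
    by apply: nondecreasing_series => n _; rewrite normr_ge0.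
  exists (fine (G 0%N w)) => _ [n _ <-].
  rewrite -lee_fin fineK// /series/= -sumEFin.
  exact: (nneseries_lim_ge n).
have fm : strongly_measurable mu f by exists s.
have fs n : (\int[mu]_w (`|f w - s n w|%:E) <= (c / (2 ^ n)%:R)%:E)%E.
  apply: le_trans (intG n); apply: ae_le_integralT => //.
  apply: filterS sf => w sfw.
  have cv : (`|s (n + m)%N w - s n w|%:E @[m --> \oo] --> `|f w - s n w|%:E)%E.
    apply: cvg_EFin; first exact: nearW.
    apply: cvg_norm; apply: cvgB; last exact: cvg_cst.
    have := sfw; rewrite -(cvg_shiftn n).
    by under eq_fun do rewrite addnC.
  rewrite -(cvg_lim _ cv)//; apply: lime_le; first by apply/cvg_ex; eexists; exact: cv.
  apply: nearW => m; apply: le_trans (nneseries_lim_ge m _) => //.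
  rewrite sumEFin lee_fin.
  rewrite (_ : s (n + m)%N w - s n w =
    \sum_(0 <= k < m) (s (n + k).+1 w - s (n + k)%N w)).
    exact: ler_norm_sum.
  rewrite (telescope_sumr_eq (fun k => s (n + k)%N w)) ?addn0//.
  by move=> k _; rewrite addnS.
exists f => //; split => //; exists s => //.
apply: (@squeeze_cvge _ _ _ _ (cst 0%E) _ (fun n => (c / (2 ^ n)%:R)%:E)).
- by apply: nearW => n; rewrite fs integral_ge0//= => w _; rewrite lee_fin.
- exact: cvg_cst.
- apply: cvg_EFin; first exact: nearW.
  under eq_fun do rewrite /= natrX -exprVn.
  have := @cvg_geometric R c 2^-1; apply.
  by rewrite ger0_norm// invf_lt1// ltr1n.
Qed.

Local Open Scope quotient_scope.

Lemma simple_bochner (s : T -> Y) :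
  simple_function s -> s \in bochner_pred mu (Y := Y).
Proof.
move=> ss; apply/bochner_predP; split; first exact: simple_strongly_measurable.
exists (fun=> s) => //; under eq_fun.
  move=> n; under eq_integral do rewrite subrr normr0.
  rewrite integral0; over.
exact: cvg_cst.
Qed.

Lemma L1_simple_dense (x : L1 mu Y) (e : R) : 0 < e ->
  exists s : {s : T -> Y | simple_function s},
    `|x - \pi_(L1 mu Y) (Bochner (simple_bochner (svalP s)))| < e.
Proof.
move=> e0; have [f ->] := L1_pi x.
have [fm [s ss sf]] := bochnerP f.
have [n ne] : exists n, (\int[mu]_w (`|f w - s n w|%:E) < e%:E)%E.
  have /fine_cvgP[[n1 _ sfin] /cvgrPdist_lt/(_ _ e0)[n2 _ sn2]] := sf.
  exists (maxn n1 n2).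
  have := sn2 _ (leq_maxr n1 n2); rewrite /= sub0r normrN => h.
  have /= <- := fineK (sfin _ (leq_maxl n1 n2)); rewrite lte_fin.
  exact: le_lt_trans (ler_norm _) h.
exists (exist _ (s n) (ss n)).
by rewrite -L1_piB norm_L1_pi -lte_fin bochner_normK.
Qed.

Let L1_complete (F : set_system (L1 mu Y)) :
  ProperFilter F -> cauchy F -> cvg F.
Proof.
move=> FF /cauchyP Fc.
pose e n : R := (2 ^ n)%:R^-1.
have e0 n : 0 < e n by rewrite invr_gt0 ltr0n expn_gt0.
have /choice[s Fs] n : exists s : {s : T -> Y | simple_function s},
    F (ball (\pi_(L1 mu Y) (Bochner (simple_bochner (svalP s)))) (2 * e n)).
  have [x Fx] := Fc _ (e0 n).
  have [s xs] := L1_simple_dense x (e0 n).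
  exists s; apply: filterS Fx => y; rewrite -!ball_normE /= => xy.
  rewrite mulr_natl mulr2n -[X in X - y](subrK x) -addrA.
  by apply: le_lt_trans (ler_normD _ _) _; rewrite ltrD// distrC.
pose u n := \pi_(L1 mu Y) (Bochner (simple_bochner (svalP (s n)))).
have uu n : `|u n.+1 - u n| <= 8 / (2 ^ n.+1)%:R.
  have [y [/=]] := filter_ex (filterI (Fs n) (Fs n.+1)).
  rewrite -!ball_normE /= -!/(u _) => uy u'y.
  rewrite -[X in X - u n](subrK y) -addrA.
  apply: le_trans (ler_normD _ _) _; rewrite [X in _ + X]distrC.
  apply: le_trans (lerD (ltW u'y) (ltW uy)) _.
  rewrite /e expnS natrM invfM; set q := (2 ^ n)%:R^-1.
  have : 0 < q := e0 n.
  by lra.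
have [|||f fb fs] := @bochner_simple_limit (fun n => sval (s n)) 8.
- by [].
- by move=> n; exact: svalP.
- move=> n; have := uu n.
  by rewrite -L1_piB norm_L1_pi -lee_fin bochner_normK.
have fP : f \in bochner_pred mu (Y := Y) by exact/bochner_predP.
pose x := \pi_(L1 mu Y) (Bochner fP).
have xu n : `|x - u n| <= 8 * e n.
  by have := fs n; rewrite -L1_piB norm_L1_pi -lee_fin bochner_normK.
apply/cvg_ex; exists x; apply/cvg_ballP => r r0.
have [n ner] : exists n, 10 * e n < r.
  have [n _ /(_ n (leqnn n))] : \forall n \near \oo, `|0 - 10 * e n| < r.
    apply: (@cvgr_dist_lt _ R^o) => //.
    under eq_fun do rewrite /e natrX -exprVn.
    have := @cvg_geometric R 10 2^-1; apply.
    by rewrite ger0_norm// invf_lt1// ltr1n.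
  by rewrite sub0r normrN => h; exists n; exact: le_lt_trans (ler_norm _) h.
apply: filterS (Fs n) => y; rewrite -!ball_normE /= -/(u n) => uy.
apply: le_lt_trans ner; rewrite -[X in X - y](subrK (u n)) -addrA.
apply: le_trans (ler_normD _ _) _.
apply: le_trans (lerD (xu n) (ltW uy)) _.
by lra.
Qed.

HB.instance Definition _ := Uniform_isComplete.Build (L1 mu Y) L1_complete.

End bochner_complete.

(* Main.v *)
(* Write x = [f] with |f| = 1 and let nu be the measure with density |f|, which
   is again non-atomic. By Sierpinski's theorem there are sets E n that are
   pairwise independent of nu-measure 1/2, so that the signs r n = 2 * 1_(E n) - 1
   are orthonormal in L2(nu). The sequence y n = [r n * f] satisfies
   |y n| = |x + y n| = |x - y n| = 1 exactly. It is weakly null by a Bessel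
   argument which needs no description of the dual: for phi bounded by C and
   a i = phi (y i),
     S = sum_(i < n) (a i)^2 = phi (sum_(i < n) a i * y i)
       <= C * int |sum_(i < n) a i * r i| dnu <= C * (S / C + C) / 2,
   hence S <= C^2 for all n and a n tends to 0. *)

Require Import Defs.
From HB Require Import structures.
From mathcomp Require Import all_boot all_order all_algebra generic_quotient.
From mathcomp Require Import all_classical all_reals all_analysis.
From mathcomp Require Import measurable_realfun lra ring.

Set Implicit Arguments.
Unset Strict Implicit.
Unset Printing Implicit Defensive.

Import Order.TTheory GRing.Theory Num.Theory.
Import numFieldNormedType.Exports.

Local Open Scope classical_set_scope.
Local Open Scope ring_scope.

(** * Non-atomic finite measures *)

Section nonatomic_halving.
Context d (T : measurableType d) (R : realType).
Variable nu : {finite_measure set T -> \bar R}.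
Hypothesis nu_nonatomic : nonatomic nu.

Local Notation m A := (fine (nu A)).

Let nuE A : measurable A -> nu A = (m A)%:E.
Proof. by move=> mA; rewrite fineK//; exact: fin_num_measure. Qed.

Let m_ge0 A : 0 <= m A.
Proof. exact/fine_ge0/measure_ge0. Qed.

Let m_set0 : m set0 = 0.
Proof. by rewrite measure0. Qed.

Let mU A B : measurable A -> measurable B -> [disjoint A & B] ->
  m (A `|` B) = m A + m B.
Proof.
move=> mA mB /disj_set2P AB; apply: EFin_inj.
by rewrite EFinD -!nuE ?measureU//; exact: measurableU.
Qed.

Let mID A B : measurable A -> measurable B -> m A = m (A `&` B) + m (A `\` B).
Proof.
move=> mA mB; apply: EFin_inj.
rewrite EFinD -!nuE//; [|exact: measurableD|exact: measurableI].
by rewrite addeC -measureDI.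
Qed.

Let m_sub A B : measurable A -> measurable B -> A `<=` B -> m (B `\` A) = m B - m A.
Proof. by move=> mA mB /setIidr AB; rewrite (mID mB mA) AB addrC addKr. Qed.

(** As [A] is no atom, some subset and its complement in [A] both have positive measure; the lighter
    of the two serves as [B]. *)
Lemma nonatomic_split A : measurable A -> 0 < m A ->
  exists B, [/\ measurable B, B `<=` A, 0 < m B & m B <= m A / 2].
Proof.
move=> mA A0; have := @nu_nonatomic A.
apply: contra_notP => /forallNP noB; split=> //.
  by change (0 < nu A)%E; rewrite nuE.
move=> B mB BA; have mAB := measurableD mA mB.
change (nu B = 0%E \/ nu (A `\` B) = 0%E).
have := m_sub mB mA BA; rewrite (nuE mB) (nuE mAB).
have := m_ge0 B; have := m_ge0 (A `\` B); rewrite !le_eqVlt.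
move=> /predU1P[<-|AB0]; first by right.
move=> /predU1P[<-|B0]; first by left.
move=> ABE; exfalso; have [AB|BA2] := leP (m B) (m A / 2).
  by apply: (noB B).
by apply: (noB (A `\` B)); split; [by []|exact: subDsetl|lra|lra].
Qed.

(** Iterating the splitting makes the measure decay geometrically. *)
Lemma nonatomic_small A (e : R) : measurable A -> 0 < m A -> 0 < e ->
  exists B, [/\ measurable B, B `<=` A, 0 < m B & m B < e].
Proof.
move=> mA A0 e0.
have iter_split n : exists B,
    [/\ measurable B, B `<=` A, 0 < m B & m B <= m A / 2 ^+ n].
  elim: n => [|n [B [mB BA B0 Bn]]]; first by exists A; rewrite expr0 divr1; split.
  have [C [mC CB C0 Cn]] := nonatomic_split mB B0.
  exists C; split=> //; first exact: subset_trans BA.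
  by rewrite exprSr invfM mulrA; lra.
have [n ne] : exists n, m A / 2 ^+ n < e.
  have := @cvg_geometric R (m A) 2^-1.
  rewrite ger0_norm// invf_lt1// ltr1n => /(_ isT) /cvgrPdist_lt /(_ e e0).
  move=> [n _ /(_ n (leqnn n))] /=; rewrite sub0r normrN exprVn => h.
  by exists n; exact: le_lt_trans (ler_norm _) h.
have [B [mB BA B0 Bn]] := iter_split n.
by exists B; split=> //; exact: le_lt_trans ne.
Qed.

(* Greedy exhaustion: each step realizes at least half of the largest possible
   increase of measure, so nothing can be gained on the union. *)
Lemma exists_maximal_below A (t : R) : measurable A -> 0 <= t ->
  exists B, [/\ measurable B, B `<=` A, m B <= t &
    forall D, measurable D -> B `<=` D -> D `<=` A -> m D <= t -> m D <= m B].
Proof.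
move=> mA t0.
pose ok := {B : set T | [/\ measurable B, B `<=` A & m B <= t]}.
have ok0 : ok by exists set0; split => //; rewrite m_set0.
have step (B : ok) : {C : ok | sval B `<=` sval C /\
    forall D : ok, sval B `<=` sval D ->
      m (sval D) - m (sval B) <= 2 * (m (sval C) - m (sval B))}.
  apply: cid; pose V := [set m (sval D) | D in [set D : ok | sval B `<=` sval D]].
  have Vub : ubound V t by move=> _ [D _ <-]; case: (svalP D).
  have VB : V (m (sval B)) by exists B.
  have hV : has_sup V by split; [exists (m (sval B)); exact: VB|exists t; exact: Vub].
  have supV (D : ok) : sval B `<=` sval D -> m (sval D) <= sup V.
    by move=> BD; apply: ub_le_sup; [exists t; exact: Vub|exists D].
  have := supV B (@subset_refl _ _).
  (* If [m B] is already the supremum, [B] is its own successor; otherwise a set within half the gap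
     of the supremum is taken. *)
  rewrite le_eqVlt => /predU1P[supB|supB].
    by exists B; split=> // D BD; rewrite subrr mulr0 subr_le0 supB; exact: supV.
  have [|_ [C BC <-]] := @sup_adherent _ V ((sup V - m (sval B)) / 2) _ hV.
    by rewrite divr_gt0// subr_gt0.
  move=> supC; exists C; split=> // D BD.
  have := supV D BD.
  by move: supC; lra.
have [F [_ FS]] := dependent_choice step ok0.
pose G n := sval (F n).
have mG n : measurable (G n) by rewrite /G; case: (svalP (F n)).
have GA n : G n `<=` A by rewrite /G; case: (svalP (F n)).
have Gt n : m (G n) <= t by rewrite /G; case: (svalP (F n)).
pose B := \bigcup_n G n.
have mB : measurable B by exact: bigcup_measurable.
have ndG : nondecreasing_seq G.
  by apply/nondecreasing_seqP => n; apply/subsetPset; case: (FS n).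
have cG : m (G n) @[n --> \oo] --> m B.
  have cnu : nu (G n) @[n --> \oo] --> (m B)%:E.
    by rewrite -nuE//; exact: nondecreasing_cvg_mu.
  by case/fine_cvgP: cnu.
exists B; split=> //.
- by move=> w [n _ /GA].
- rewrite -(cvg_lim _ cG)//; apply: limr_le; first by apply/cvg_ex; exists (m B).
  exact: nearW.
- move=> D mD BD DA Dt; pose D' : ok := exist _ D (And3 mD DA Dt).
  (* [D] competes at every stage, since it contains each [G n]. In the limit the right-hand side
     vanishes, hence [m D <= m B]. *)
  have h n : m D - m (G n) <= 2 * (m (G n.+1) - m (G n)).
    have [_ /(_ D')] := FS n; apply.
    by apply: subset_trans BD; move=> w Gw; exists n.
  have cG1 : m (G n.+1) @[n --> \oo] --> m B.
    by have := cG; rewrite -(cvg_shiftS (fun n => m (G n))).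
  have cl : m D - m (G n) @[n --> \oo] --> m D - m B.
    by apply: cvgB => //; exact: cvg_cst.
  have cr : 2 * (m (G n.+1) - m (G n)) @[n --> \oo] --> 2 * (m B - m B).
    by apply: cvgM; [exact: cvg_cst|exact: cvgB].
  have : m D - m B <= 2 * (m B - m B).
    by apply: (ler_cvg_to cl cr); exact: nearW.
  by rewrite subrr mulr0 subr_le0.
Qed.

(** Sierpinski's theorem. If a maximal [B] had measure below [t], a piece of the rest of [A] of
    positive measure less than [t - m B] could be added to it. *)
Lemma nonatomic_value A (t : R) : measurable A -> 0 <= t <= m A ->
  exists B, [/\ measurable B, B `<=` A & m B = t].
Proof.
move=> mA /andP[t0 tA].
have [B [mB BA Bt Bmax]] := exists_maximal_below mA t0.
exists B; split=> //; apply/eqP; move: Bt; rewrite le_eqVlt => /orP[//|Bt].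
have ABE := m_sub mB mA BA.
have [|||C [mC CAB C0 Ct]] := @nonatomic_small (A `\` B) (t - m B).
- exact: measurableD.
- by rewrite ABE subr_gt0; exact: lt_le_trans tA.
- by rewrite subr_gt0.
have BCE : m (B `|` C) = m B + m C.
  apply: mU => //; apply/disj_set2P; rewrite -subset0 => w [Bw /CAB[_]]; exact.
have : m (B `|` C) <= m B.
  apply: Bmax; [exact: measurableU|exact: subsetUl| |rewrite BCE; lra].
  by rewrite subUset; split=> // w /CAB[].
by rewrite BCE => h; exfalso; lra.
Qed.

(** Induction on [L] for all [D] at once: the parts of [D] inside and outside the head [A] are
    bisected separately and the results united. *)
Lemma nonatomic_bisect (L : seq (set T)) D : measurable D ->
  (forall A, List.In A L -> measurable A) ->
  exists E, [/\ measurable E, E `<=` D, m E = m D / 2 &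
    forall A, List.In A L -> m (E `&` A) = m (D `&` A) / 2].
Proof.
elim: L D => [|A L IH] D mD mL.
  have [|E [mE ED Em]] := @nonatomic_value D (m D / 2) mD.
    by have := m_ge0 D; lra.
  by exists E; split.
have mA : measurable A by apply: mL; left.
have {}mL B : List.In B L -> measurable B by move=> BL; apply: mL; right.
have [||E1 [mE1 E1D E1m E1L]] := IH (D `&` A); [exact: measurableI|by []|].
have [||E2 [mE2 E2D E2m E2L]] := IH (D `\` A); [exact: measurableD|by []|].
have E12 : E1 `&` E2 = set0.
  by rewrite -subset0 => w [/E1D[_ Aw] /E2D[_]].
have mIA B : measurable B -> m (D `&` B) = m (D `&` A `&` B) + m ((D `\` A) `&` B).
  move=> mB; rewrite (@mID (D `&` B) A)//; last exact: measurableI.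
  by rewrite !setDE (setIAC D B) (setIAC D B).
exists (E1 `|` E2); split.
- exact: measurableU.
- by rewrite subUset; split; [apply: subset_trans E1D _|apply: subset_trans E2D _];
    move=> w [].
- rewrite mU//; last exact/disj_set2P.
  by rewrite E1m E2m (mID mD mA) mulrDl.
- move=> B [<-|BL].
    (* [E2] lies outside [A], so only [E1], half of the trace of [D] on [A], counts. *)
    rewrite setIUl [E2 `&` A](_ : _ = set0); last first.
      by rewrite -subset0 => w [/E2D[_]].
    rewrite setU0 -E1m; congr (fine (nu _)); apply/setIidl => w /E1D[] //.
  have mB := mL _ BL.
  rewrite setIUl mU; [|exact: measurableI|exact: measurableI|].
    by rewrite E1L// E2L// (mIA B)// mulrDl.
  by apply/disj_set2P; rewrite setIACA E12 set0I.
Qed.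

(** Each set is chosen to bisect all earlier ones, so it meets an earlier set in half of one half of
    the total mass. *)
Lemma nonatomic_independent_halves : exists E : nat -> set T,
  [/\ forall n, measurable (E n), forall n, m (E n) = m setT / 2 &
    forall i j, i != j -> m (E i `&` E j) = m setT / 4].
Proof.
(* Measurability of the members is a premise inside the choice, so that [next] is a total function;
   lists with a non-measurable member get the default [set0]. *)
have ex (L : seq (set T)) : {E | measurable E /\
    ((forall A, List.In A L -> measurable A) -> m E = m setT / 2 /\
      forall A, List.In A L -> m (E `&` A) = m A / 2)}.
  apply: cid; have [mL|nL] := pselect (forall A, List.In A L -> measurable A).
    have [E [mE _ Em EL]] := nonatomic_bisect (@measurableT _ T) mL.
    by exists E; split=> // _; split=> // A AL; rewrite EL// setTI.
  by exists set0; split.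
pose next L := sval (ex L).
(* [L n] holds the first [n] chosen sets, the latest at the head. *)
pose L n := iter n (fun L => next L :: L) [::].
have mL n A : List.In A (L n) -> measurable A.
  elim: n A => [//|n IH] A [<-|]; last exact: IH.
  by rewrite /next; case: (svalP (ex (L n))).
pose E n := next (L n).
have EL i j : (i < j)%N -> List.In (E i) (L j).
  elim: j => // j IH; rewrite ltnS leq_eqVlt => /predU1P[->|/IH]; first by left.
  by right.
have [mE Em Eij] : [/\ forall n, measurable (E n), forall n, m (E n) = m setT / 2 &
    forall i j, (i < j)%N -> m (E i `&` E j) = m setT / 4].
  have EP n := (svalP (ex (L n))).2 (mL n).
  split=> [n|n|i j ij]; first by case: (svalP (ex (L n))).
    by case: (EP n).
  have [_ /(_ _ (EL _ _ ij))] := EP j; rewrite setIC => ->.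
  by case: (EP i) => ->; lra.
exists E; split=> // i j; rewrite neq_ltn => /orP[ij|ji]; first exact: Eij.
by rewrite setIC Eij.
Qed.

End nonatomic_halving.

(** * Measures with a density *)

(** The proofs [g0] and [ig] are carried as arguments so that the measure and finiteness instances
    below can be inferred from the term. *)
Definition density_measure d (T : measurableType d) (R : realType)
    (mu : {measure set T -> \bar R}) (g : T -> R)
    (g0 : forall w, 0 <= g w) (ig : mu.-integrable setT (EFin \o g)) :=
  fun A : set T => (\int[mu]_(w in A) (g w)%:E)%E.

Section density_measure.
Context d (T : measurableType d) (R : realType).
Variables (mu : {measure set T -> \bar R}) (g : T -> R).
Hypotheses (g0 : forall w, 0 <= g w) (ig : mu.-integrable setT (EFin \o g)).
Local Notation nu := (density_measure g0 ig).

Let nu_set0 : nu set0 = 0%E.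
Proof. exact: integral_set0. Qed.

Let nu_ge0 A : (0 <= nu A)%E.
Proof. by apply: integral_ge0 => w _; rewrite lee_fin. Qed.

Let nu_sigma_additive : semi_sigma_additive nu.
Proof.
by apply: semi_sigma_additive_nng_induced => //; exact: measurable_int ig.
Qed.

HB.instance Definition _ :=
  isMeasure.Build _ _ _ nu nu_set0 nu_ge0 nu_sigma_additive.

Let nu_fin : fin_num_fun nu.
Proof.
move=> A mA; apply: integrable_fin_num => //.
exact: integrableS ig.
Qed.

HB.instance Definition _ := Measure_isFinite.Build _ _ _ nu nu_fin.

(** On the part [P] of [A] where [g] is nonzero, [nu] and [mu] have the same null sets, so a
    [nu]-atom [A] would make [P] a [mu]-atom. *)
Lemma nonatomic_density : nonatomic mu -> nonatomic nu.
Proof.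
move=> mu_na A [mA A0 nuA].
have mg : measurable_fun setT g by exact/measurable_EFinP/(measurable_int mu).
pose P := A `&` [set w | g w != 0].
have mP : measurable P.
  apply: measurableI => //.
  have -> : [set w | g w != 0] = g @^-1` [set~ 0].
    by apply/seteqP; split => w /= /eqP.
  by rewrite -[X in measurable X]setTI; apply: mg => //; exact: measurableC.
have null_mu B : measurable B -> B `<=` P -> nu B = 0%E -> mu B = 0%E.
  move=> mB BP nuB0.
  have mgB : measurable_fun B (EFin \o g).
    by apply: measurable_funS (measurable_int mu ig).
  have /(ae_eq_integral_abs mu mB mgB) : (\int[mu]_(w in B) `|(EFin \o g) w| = 0)%E.
    by rewrite -[RHS]nuB0; apply: eq_integral => w _; rewrite /= ger0_norm.
  move=> [N [mN N0 BN]]; apply/eqP; rewrite -measure_le0 -N0.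
  apply: le_measure; rewrite ?inE// => w Bw; apply: BN => /(_ Bw) /= [].
  by apply/eqP; case: (BP _ Bw).
have nuP B : measurable B -> mu B = 0%E -> nu B = 0%E.
  move=> mB B0; apply: null_set_integral => //.
  by apply: measurable_funS (measurable_int mu ig).
(* As [g] vanishes on [A] outside [P], all the mass of [A] sits in [P], which therefore cannot be
   [mu]-null. *)
have nuAP : nu (A `\` P) = 0%E.
  apply: integral0_eq => w [Aw]; rewrite /P /= => /not_andP[//|/negP].
  by rewrite negbK => /eqP ->.
apply: (mu_na P); split => //.
  rewrite lt0e measure_ge0 andbT; apply/eqP => /(nuP _ mP) P0.
  move: A0; change ((0 < nu A)%E -> False).
  have -> : nu A = (nu (A `\` P) + nu (A `&` P))%E := measureDI nu mA mP.
  by rewrite (setIidr (@subIsetl _ _ _)) P0 nuAP adde0 ltxx.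
move=> B mB BP; have [B0|AB0] := nuA B mB (subset_trans BP (@subIsetl _ _ _)).
  by left; exact: null_mu.
right; apply: null_mu; [exact: measurableD|exact: subDsetl|].
apply/eqP; rewrite -measure_le0; change (nu (P `\` B) <= 0)%E; rewrite -AB0.
apply: le_measure; rewrite ?inE; [exact: measurableD|exact: measurableD|].
by apply: setSD; exact: subIsetl.
Qed.

End density_measure.

(** * Orthonormal signs *)

(** Along the sets [E n] below, these functions play the role of the Rademacher functions. *)
Definition sign_fun {T : Type} {R : realType} (A : set T) (w : T) : R :=
  2 * \1_A w - 1.

Section sign_fun.
Context d (T : measurableType d) (R : realType).
Variable mu : {measure set T -> \bar R}.
Local Notation sgf := (@sign_fun T R).

Lemma sign_fun_sqr A w : sgf A w * sgf A w = 1.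
Proof. by rewrite /sign_fun indicE; case: (w \in A) => /=; ring. Qed.

Lemma norm_sign_fun A w : `|sgf A w| = 1.
Proof.
rewrite /sign_fun indicE; case: (w \in A); last by rewrite mulr0 sub0r normrN1.
by rewrite mulr1 [_ - _](_ : _ = 1) ?normr1//; ring.
Qed.

Lemma integrable_Rsum (I : Type) (s : seq I) (h : I -> T -> R) :
  (forall i, mu.-integrable setT (EFin \o h i)) ->
  mu.-integrable setT (EFin \o (fun w => \sum_(i <- s) h i w)).
Proof.
move=> ih; have := integrable_sum measurableT s (P := xpredT) (fun i _ => ih i).
by apply: eq_integrable => // w _; rewrite /= sumEFin.
Qed.

Lemma Rintegral_sum (I : Type) (s : seq I) (h : I -> T -> R) :
  (forall i, mu.-integrable setT (EFin \o h i)) ->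
  \int[mu]_w (\sum_(i <- s) h i w) = \sum_(i <- s) \int[mu]_w h i w.
Proof.
move=> ih; elim: s => [|i s IH].
  under eq_Rintegral do rewrite big_nil.
  by rewrite big_nil Rintegral_cst// mul0r.
under eq_Rintegral do rewrite big_cons.
by rewrite big_cons RintegralD// ?IH//; exact: integrable_Rsum.
Qed.

Variables (g : T -> R) (ig : mu.-integrable setT (EFin \o g)).

Lemma integrable_indic_mul A : measurable A ->
  mu.-integrable setT (EFin \o (fun w => \1_A w * g w)).
Proof.
move=> mA; have : mu.-integrable A (EFin \o g) by exact: integrableS ig.
move/(integrable_mkcond _ mA); apply: eq_integrable => // w _.
by rewrite /= /patch indicE; case: ifPn => /=; rewrite ?mul1r ?mul0r.
Qed.

Lemma Rintegral_indic_mul A :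
  \int[mu]_w (\1_A w * g w) = \int[mu]_(w in A) g w.
Proof.
rewrite [RHS]Rintegral_mkcond; apply: eq_Rintegral => w _.
by rewrite /patch indicE; case: ifPn; rewrite ?mul1r ?mul0r.
Qed.

Let sign_fun_mulE A B w : sgf A w * sgf B w * g w =
  4 * (\1_(A `&` B) w * g w) - 2 * (\1_A w * g w) - 2 * (\1_B w * g w) + g w.
Proof. by rewrite /sign_fun indicI/=; ring. Qed.

Let integrable_Zindic k C : measurable C ->
  mu.-integrable setT (EFin \o (fun w => k * (\1_C w * g w))).
Proof.
by move=> mC; exact: (integrableZl measurableT k (integrable_indic_mul mC)).
Qed.

(** Intermediate differences of the expansion in [sign_fun_mulE]; integrating it term by term
    requires each of them to be integrable. *)
Let integrable_sign_fun_mulB A B : measurable A -> measurable B ->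
  mu.-integrable setT (EFin \o (fun w =>
    4 * (\1_(A `&` B) w * g w) - 2 * (\1_A w * g w))) /\
  mu.-integrable setT (EFin \o (fun w =>
    4 * (\1_(A `&` B) w * g w) - 2 * (\1_A w * g w) - 2 * (\1_B w * g w))).
Proof.
move=> mA mB; have mAB := measurableI _ _ mA mB.
have iAB := integrableB measurableT (integrable_Zindic 4 mAB)
  (integrable_Zindic 2 mA).
split; first exact: iAB.
exact: (integrableB measurableT iAB (integrable_Zindic 2 mB)).
Qed.

Lemma integrable_sign_fun_mul2 A B : measurable A -> measurable B ->
  mu.-integrable setT (EFin \o (fun w => sgf A w * sgf B w * g w)).
Proof.
move=> mA mB; rewrite (funext (sign_fun_mulE A B)).
have [_ i3] := integrable_sign_fun_mulB mA mB.
exact: (integrableD measurableT i3 ig).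
Qed.

(** Expanding the product reduces orthogonality of signs to the weights of [A], [B] and their
    intersection. *)
Lemma Rintegral_sign_fun_mul2 A B : measurable A -> measurable B ->
  \int[mu]_w (sgf A w * sgf B w * g w) =
  4 * (\int[mu]_(w in A `&` B) g w) - 2 * (\int[mu]_(w in A) g w)
  - 2 * (\int[mu]_(w in B) g w) + \int[mu]_w g w.
Proof.
move=> mA mB; have mAB := measurableI _ _ mA mB.
have [i2 i3] := integrable_sign_fun_mulB mA mB.
under eq_Rintegral do rewrite sign_fun_mulE.
rewrite RintegralD// RintegralB//; last exact: integrable_Zindic.
rewrite RintegralB//; [|exact: integrable_Zindic..].
rewrite !RintegralZl//; [|exact: integrable_indic_mul..].
by rewrite !Rintegral_indic_mul.
Qed.

End sign_fun.

Section orthonormal_signs.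
Context d (T : measurableType d) (R : realType).
Variables (mu : {measure set T -> \bar R}) (g : T -> R).
Hypotheses (g0 : forall w, 0 <= g w) (ig : mu.-integrable setT (EFin \o g)).
Local Notation sgf := (@sign_fun T R).

(** Independent halves for the density measure of [g], a probability. Off the diagonal the expansion
    reads 4 * 1/4 - 2 * 1/2 - 2 * 1/2 + 1 = 0; on it the squared sign is 1. *)
Lemma exists_orthonormal_signs : nonatomic mu -> \int[mu]_w g w = 1 ->
  exists E : nat -> set T, [/\ forall n, measurable (E n),
    forall n, \int[mu]_(w in E n) g w = 1 / 2 &
    forall i j, \int[mu]_w (sgf (E i) w * sgf (E j) w * g w) = (i == j)%:R].
Proof.
move=> mu_na g1.
have [E [mE Ehalf Equarter]] :=
  nonatomic_independent_halves (@nonatomic_density _ _ _ _ _ g0 ig mu_na).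
have {}Ehalf n : \int[mu]_(w in E n) g w = 1 / 2.
  (* The density measure unfolds to this integral, so [Ehalf] applies by conversion. *)
  by transitivity ((\int[mu]_w g w) / 2); [exact: Ehalf|rewrite g1].
exists E; split=> // i j; have [->|ij] := eqVneq.
  by under eq_Rintegral do rewrite sign_fun_sqr mul1r.
rewrite Rintegral_sign_fun_mul2// !Ehalf.
have -> : \int[mu]_(w in E i `&` E j) g w = 1 / 4.
  by transitivity ((\int[mu]_w g w) / 4); [exact: Equarter|rewrite g1].
by rewrite g1 mulr0n; lra.
Qed.

Variable E : nat -> set T.
Hypotheses (mE : forall n, measurable (E n))
  (orthoE : forall i j, \int[mu]_w (sgf (E i) w * sgf (E j) w * g w) = (i == j)%:R).

(** Pythagoras: the square expands into a double sum of which only the diagonal survives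
    integration. The same expansion gives integrability. *)
Lemma Rintegral_sum_sign_sqr (a : nat -> R) n :
  mu.-integrable setT
    (EFin \o (fun w => (\sum_(i < n) a i * sgf (E i) w) ^+ 2 * g w)) /\
  \int[mu]_w ((\sum_(i < n) a i * sgf (E i) w) ^+ 2 * g w) = \sum_(i < n) a i ^+ 2.
Proof.
have sqrE w : (\sum_(i < n) a i * sgf (E i) w) ^+ 2 * g w =
    \sum_(i < n) \sum_(j < n) a i * a j * (sgf (E i) w * sgf (E j) w * g w).
  rewrite expr2 mulr_suml mulr_suml; apply: eq_bigr => i _.
  by rewrite mulr_sumr mulr_suml; apply: eq_bigr => j _; ring.
have iij (i j : 'I_n) : mu.-integrable setT
    (EFin \o (fun w => a i * a j * (sgf (E i) w * sgf (E j) w * g w))).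
  exact: (integrableZl measurableT (a i * a j)
    (integrable_sign_fun_mul2 ig (mE i) (mE j))).
have ii (i : 'I_n) : mu.-integrable setT (EFin \o (fun w =>
    \sum_(j < n) a i * a j * (sgf (E i) w * sgf (E j) w * g w))).
  exact: integrable_Rsum.
split.
  rewrite (funext sqrE); exact: integrable_Rsum.
under eq_Rintegral do rewrite sqrE.
rewrite Rintegral_sum//; apply: eq_bigr => i _.
rewrite Rintegral_sum// (bigD1 i)//= big1 ?addr0 => [|j ji].
  rewrite RintegralZl//; last exact: integrable_sign_fun_mul2.
  by rewrite orthoE eqxx mulr1.
rewrite RintegralZl//; last exact: integrable_sign_fun_mul2.
by rewrite orthoE eq_sym [_ == _](negbTE ji) mulr0.
Qed.

(* Instead of Cauchy-Schwarz, the pointwise bound 2 |h| <= h^2 / c + c. *)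
Lemma Rintegral_norm_sum_sign_le (a : nat -> R) (c : R) n : 0 < c ->
  \int[mu]_w g w = 1 ->
  \int[mu]_w (`|\sum_(i < n) a i * sgf (E i) w| * g w) <=
    (c^-1 * (\sum_(i < n) a i ^+ 2) + c) / 2.
Proof.
move=> c0 g1; have [isqr <-] := Rintegral_sum_sign_sqr a n.
set h := fun w => \sum_(i < n) a i * sgf (E i) w.
have ih : mu.-integrable setT (EFin \o (fun w => `|h w| * g w)).
  apply: (@eq_integrable _ _ _ _ _ _
    (EFin \o (Num.norm \o (fun w => h w * g w)))) => //.
    by move=> w _ /=; rewrite normrM [`|g w|]ger0_norm.
  apply: integrable_norm; rewrite /h.
  (* The sign of [setT] is constantly 1, so integrability of a single sign times [g] is an instance
     of that for products of two signs. *)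
  rewrite [X in _ \o X](_ : _ =
    fun w => \sum_(i < n) a i * (sgf (E i) w * sgf setT w * g w)).
    apply: integrable_Rsum => i.
    exact: (integrableZl measurableT (a i)
      (integrable_sign_fun_mul2 ig (mE i) measurableT)).
  apply/funext => w; rewrite mulr_suml; apply: eq_bigr => i _.
  by rewrite [sgf setT w]/sign_fun indicT /=; ring.
have iR : mu.-integrable setT
    (EFin \o (fun w => c^-1 / 2 * (h w ^+ 2 * g w) + c / 2 * g w)).
  exact: (integrableD measurableT (integrableZl measurableT (c^-1 / 2) isqr)
    (integrableZl measurableT (c / 2) ig)).
(* The bound is itself an integral, as [g] has integral 1, so it suffices to compare integrands. *)
have -> : (c^-1 * (\int[mu]_w (h w ^+ 2 * g w)) + c) / 2 =
    \int[mu]_w (c^-1 / 2 * (h w ^+ 2 * g w) + c / 2 * g w).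
  rewrite RintegralD//; [|exact: (integrableZl measurableT _ isqr)|
    exact: (integrableZl measurableT _ ig)].
  by rewrite !RintegralZl// g1; ring.
apply: le_Rintegral => // w _.
rewrite mulrA -mulrDl; apply: ler_wpM2r => //.
have : 0 <= (`|h w| - c) ^+ 2 / c by rewrite divr_ge0 ?sqr_ge0 ?ltW.
rewrite -[h w ^+ 2]real_normK ?num_real//; set t := `|h w|.
have -> : (t - c) ^+ 2 / c = c^-1 * t ^+ 2 - 2 * t + c by field; rewrite gt_eqF.
by lra.
Qed.

End orthonormal_signs.

(** * Lebesgue-Bochner spaces *)

Section bochner_representatives.
Context d (T : measurableType d) (R : realType).
Variables (mu : {finite_measure set T -> \bar R}) (Y : normedModType R).
Local Open Scope quotient_scope.

(** Multiplying by an indicator keeps approximants simple and does not increase the norm of the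
    pointwise error. *)
Lemma bochner_integrable_indicZ (E : set T) (f : T -> Y) : measurable E ->
  bochner_integrable mu f -> bochner_integrable mu (fun w => \1_E w *: f w).
Proof.
move=> mE [[s ss sf] [t st tf]].
have simple_indicZ (u : T -> Y) : simple_function u ->
    simple_function (fun w => \1_E w *: u w).
  (* The indicator is boolean membership cast to [R], so this is a binary operation on two simple
     functions. *)
  exact: (simple_function_op (fun (b : bool) y => b%:R *: y) (simple_function_mem mE)).
split.
  exists (fun n w => \1_E w *: s n w) => [n|]; first exact: simple_indicZ.
  by apply: filterS sf => w sfw; apply: cvgZl_tmp.
exists (fun n w => \1_E w *: t n w) => [n|]; first exact: simple_indicZ.
apply: (squeeze_cvge _ (@cvg_cst _ 0%E _ _ _) tf).
apply: nearW => n; rewrite integral_ge0 => [/=|w _]; last by rewrite lee_fin.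
apply: ae_le_integralT => [w|w|]; rewrite ?lee_fin//.
apply/aeW => w; rewrite lee_fin -scalerBr normrZ ger0_norm// ler_piMl//.
Qed.

Lemma bochner_integrable_ae (f g : T -> Y) : f = g %[ae mu] ->
  strongly_measurable mu g -> bochner_integrable mu f -> bochner_integrable mu g.
Proof.
move=> fg mg [_ [t st tf]]; split=> //; exists t => //.
rewrite [X in X @ _ --> _](_ : _ = fun n => (\int[mu]_w (`|f w - t n w|%:E))%E)//.
apply/funext => n; apply: ae_eq_integralT => [w|w|]; rewrite ?lee_fin//.
by apply: filterS fg => w /(_ I) ->.
Qed.

(** A representative is in general a limit of simple functions only almost everywhere, and its norm
    need not be measurable. Passing to an everywhere limit makes the norm usable as a density. *)
Lemma L1_measurable_norm_repr (x : L1 mu Y) : exists2 f : bochner mu Y,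
  x = \pi_(L1 mu Y) f & measurable_fun setT (fun w => `|f w|).
Proof.
have [f ->] := L1_pi x.
have [g [s [ss sg fg]]] := strongly_measurable_lim (bochner_measurable f).
have gP : g \in bochner_pred mu (Y := Y).
  apply/bochner_predP; apply: bochner_integrable_ae fg _ (bochnerP f).
  by exists s => //; exact/aeW.
exists (Bochner gP); first exact/L1_eqP.
exact: lim_simple_measurable_norm ss sg.
Qed.

(** All vectors whose norm is needed below are scalar multiples of one [f], so their norms become
    scalar integrals weighted by the norm of [f]. *)
Lemma norm_L1_scale (f b : bochner mu Y) (h : T -> R) :
  (forall w, b w = h w *: f w) ->
  `|\pi_(L1 mu Y) b| = \int[mu]_w (`|h w| * `|f w|).
Proof.
move=> bE; rewrite norm_L1_pi; apply: eq_Rintegral => w _.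
by rewrite bE normrZ.
Qed.

Lemma bochner_sumE (I : Type) (s : seq I) (b : I -> bochner mu Y) w :
  (\sum_(i <- s) b i) w = \sum_(i <- s) b i w.
Proof. by apply: (big_morph (fun b : bochner mu Y => b w)). Qed.

Lemma L1_pi_sum (I : Type) (s : seq I) (b : I -> bochner mu Y) :
  \pi_(L1 mu Y) (\sum_(i <- s) b i) = \sum_(i <- s) \pi_(L1 mu Y) (b i).
Proof. by apply: (big_morph _ (@L1_piD _ _ _ _ _)). Qed.

End bochner_representatives.

(** * Bounded functionals and square-summable sequences *)

Lemma continuous_linear_norm_bound (R : realType) (X : normedModType R)
    (phi : {linear X -> R^o}) : continuous phi ->
  exists2 C : R, 0 < C & forall z, `|phi z| <= C * `|z|.
Proof.
move=> /linear_bounded_continuous/linear_boundedP.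
by case/pinfty_ex_gt0 => C C0 phiC; exists C.
Qed.

(** The series of squares has nondecreasing bounded partial sums, so it converges and its terms tend
    to 0. *)
Lemma bounded_sum_sqr_cvg0 (R : realType) (a : nat -> R) (M : R) :
  (forall n, \sum_(i < n) a i ^+ 2 <= M) -> a n @[n --> \oo] --> (0 : R).
Proof.
move=> aM.
have cv : cvgn (series (fun n => a n ^+ 2)).
  apply: nondecreasing_is_cvgn.
    by apply: nondecreasing_series => n _; rewrite sqr_ge0.
  by exists M => _ [n _ <-]; rewrite /series/= big_mkord.
have := cvg_series_cvg_0 cv => /cvgrPdist_lt a0.
apply/cvgrPdist_lt => e e0; apply: filterS (a0 _ (exprn_gt0 2 e0)) => n.
rewrite !sub0r !normrN normrX ltr_pXn2r// nnegrE ?normr_ge0//.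
exact: ltW.
Qed.

Theorem corollary2p5 (d : measure_display) (T : measurableType d)
    (R : realType) (mu : {finite_measure set T -> \bar R})
    (Y : completeNormedModType R) :
  nonatomic mu -> weakly_almost_square (L1 mu Y).
Proof.
move=> mu_na x; have [f -> mf] := L1_measurable_norm_repr x.
set g := fun w => `|f w| in mf.
have g0 w : 0 <= g w by rewrite /g.
rewrite norm_L1_pi => g1.
have ig : mu.-integrable setT (EFin \o g).
  apply/integrableP; split; first exact/measurable_EFinP.
  under eq_integral do rewrite /= ger0_norm//.
  by rewrite ltey_eq (bochner_integrable_fin (bochnerP f)).
have [E [mE Ehalf orthoE]] := exists_orthonormal_signs g0 ig mu_na g1.
have EfP n : (fun w => \1_(E n) w *: f w) \in bochner_pred mu (Y := Y).
  exact/bochner_predP/bochner_integrable_indicZ/bochnerP.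
pose Ef n : bochner mu Y := Bochner (EfP n).
(* This is the sign of [E n] times [f]; written with the module operations, it lies in [bochner]
   without a separate proof. *)
pose b n : bochner mu Y := 2 *: Ef n - f.
have bE n w : b n w = sign_fun (E n) w *: f w.
  rewrite -[LHS]/(2 *: (\1_(E n) w *: f w) - f w).
  by rewrite /sign_fun scalerA scalerBl scale1r.
pose y n := \pi_(L1 mu Y)%qT (b n).
have y1 n : `|y n| = 1.
  rewrite (norm_L1_scale (bE n)) -[RHS]g1; apply: eq_Rintegral => w _.
  by rewrite norm_sign_fun mul1r.
(* The sum is [f] doubled on [E n] and 0 elsewhere, and [E n] carries half of the weight [g]. *)
have xDy n : `|\pi_(L1 mu Y)%qT f + y n| = 1.
  rewrite -L1_piD (@norm_L1_scale _ _ _ _ _ f _ (fun w => 2 * \1_(E n) w)); last first.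
    move=> w; rewrite -[LHS]/(f w + b n w) bE /sign_fun.
    by rewrite scalerBl scale1r addrC subrK.
  under eq_Rintegral do rewrite ger0_norm// -mulrA.
  rewrite RintegralZl//; last exact: integrable_indic_mul.
  by rewrite Rintegral_indic_mul Ehalf; lra.
(* The difference is [f] doubled off [E n], of norm 2 - 2 * 1/2. *)
have xBy n : `|\pi_(L1 mu Y)%qT f - y n| = 1.
  rewrite -L1_piB (@norm_L1_scale _ _ _ _ _ f _ (fun w => 2 - 2 * \1_(E n) w)); last first.
    move=> w; rewrite -[LHS]/(f w - b n w) bE /sign_fun.
    rewrite -[X in X - _]scale1r -scalerBl; congr (_ *: _); ring.
  have -> : \int[mu]_w (`|2 - 2 * \1_(E n) w| * `|f w|) =
      \int[mu]_w (2 * g w - 2 * (\1_(E n) w * g w)).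
    apply: eq_Rintegral => w _; rewrite ger0_norm ?subr_ge0; first by rewrite /g; ring.
    by rewrite indicE; case: (w \in E n); rewrite ?mulr1 ?mulr0.
  have iE := integrable_indic_mul ig (mE n).
  rewrite RintegralB//; [|exact: (integrableZl measurableT 2 ig)|
    exact: (integrableZl measurableT 2 iE)].
  rewrite !RintegralZl// Rintegral_indic_mul Ehalf g1; lra.
exists y; split => [phi cphi|n|||]; rewrite ?y1//; last first.
- by under eq_fun do rewrite y1; exact: cvg_cst.
- by under eq_fun do rewrite xBy; exact: cvg_cst.
- by under eq_fun do rewrite xDy; exact: cvg_cst.
have [C C0 phiC] := continuous_linear_norm_bound cphi.
apply: (@bounded_sum_sqr_cvg0 _ _ (C ^+ 2)) => n.
pose a i : R := phi (y i).
rewrite -/(a _).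
set S := \sum_(i < n) _.
(* One factor [a i] of each square stays a coefficient, the other is read as [phi (y i)]. *)
have SE : S = phi (\sum_(i < n) a i *: y i).
  by rewrite linear_sum; apply: eq_bigr => i _; rewrite linearZ.
pose z : bochner mu Y := \sum_(i < n) a i *: b i.
have zE w : z w = (\sum_(i < n) a i * sign_fun (E i) w) *: f w.
  rewrite bochner_sumE scaler_suml; apply: eq_bigr => i _.
  by rewrite -[LHS]/(a i *: b i w) bE scalerA.
have yz : \sum_(i < n) a i *: y i = \pi_(L1 mu Y)%qT z.
  by rewrite L1_pi_sum; apply: eq_bigr => i _; rewrite L1_piZ.
(* With [c] taken to be the bound [C] of the functional, [S] returns on the right with factor one
   half and can be absorbed. *)
have : S <= C * ((C^-1 * S + C) / 2).
  rewrite [leLHS]SE; apply: le_trans (ler_norm _) _; apply: le_trans (phiC _) _.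
  rewrite ler_pM2l// yz (norm_L1_scale zE).
  exact: Rintegral_norm_sum_sign_le.
have -> : C * ((C^-1 * S + C) / 2) = (S + C ^+ 2) / 2 by field; rewrite gt_eqF.
by lra.
Qed.
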